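(* For every integer $\Delta \ge 2$ there exist a simple undirected graph $G=(V,E)$ of maximum degree $\Delta$, a port numbering $p$ of $G$, and nodes $v,u,w\in V$ with $u$ and $w$ two distinct neighbours of $v$, such that for every algorithm (distributed state machine) $\mathcal{A}$ in the class $\mathcal{SV}$, in the execution of $\mathcal{A}$ in $(G,p)$ the node $v$ receives identical messages from its neighbours $u$ and $w$ in each of the rounds $1,2,\dotsc,2\Delta-2$.
   Context: Graphs are simple and undirected; $[n]=\{1,\dots,n\}$; $\mathcal{F}(\Delta)$ is the class of all simple undirected graphs of maximum degree at most $\Delta$. Port numberings. A port of $G=(V,E)$ is a pair $(v,i)$ with $v\in V$, $i\in[\deg(v)]$; $P(G)$ is the set of ports. A port numbering of $G$ is a bijection $p\colon P(G)\to P(G)$ such that $p(v,i)=(u,j)$ for some $i,j$ if and only if $\{v,u\}\in E$. If $p(v,i)=(u,j)$, output port $i$ of $v$ is connected to input port $j$ of $u$. State machines. Let $X$ be a finite set of local inputs with $\emptyset\in X$ (''no input''). A distributed state machine for $(\mathcal{F}(\Delta),X)$ is a tuple $\mathcal{A}=(Y,Z,\sigma_0,M,\mu,\sigma)$ where $Y$ is a set of states, $Z\subseteq Y$ is a finite set of stopping states, $\sigma_0\colon\{0,1,\dots,\Delta\}\times X\to Y$ gives the initial state, $M$ is a set of messages with $\epsilon\in M$ (''no message''), $\mu\colon Y\times[\Delta]\to M$ constructs outgoing messages with $\mu(z,i)=\epsilon$ for all $z\in Z$, $i\in[\Delta]$, and $\sigma\colon Y\times M^\Delta\to Y$ is the transition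 function with $\sigma(z,\overline m)=z$ for all $z\in Z$, $\overline m\in M^\Delta$. Executions. For $G=(V,E)\in\mathcal{F}(\Delta)$, an input $f\colon V\to X$ and a port numbering $p$, the execution of $\mathcal{A}$ in $(G,f,p)$ is defined by $x_0(v)=\sigma_0(\deg(v),f(v))$; if $(v,i)=p(u,j)$, then in round $r+1$ node $v$ receives the message $a_{r+1}(v,i)=\mu(x_r(u),j)$ from its neighbour $u$; with $\overline a_{r+1}(v)=(a_{r+1}(v,1),\dots,a_{r+1}(v,\deg(v)),\epsilon,\dots,\epsilon)\in M^\Delta$, set $x_{r+1}(v)=\sigma(x_r(v),\overline a_{r+1}(v))$. The execution in $(G,p)$ is the execution in $(G,f,p)$ with $f$ constantly equal to $\emptyset$. Class $\mathcal{SV}$. For $\overline a=(a_1,\dots,a_\Delta)\in M^\Delta$ let $\mathrm{set}(\overline a)=\{a_1,\dots,a_\Delta\}$. The class $\mathcal{SV}$ consists of all distributed state machines such that $\mathrm{set}(\overline a)=\mathrm{set}(\overline b)$ implies $\sigma(y,\overline a)=\sigma(y,\overline b)$ for all $y\in Y$. In the claim, $\mathcal{A}$ ranges over the state machines in $\mathcal{SV}$ for $(\mathcal{F}(\Delta),X)$, with any finite $X\ni\emptyset$. *)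

(* Defs.v *)
From Stdlib Require List.
From mathcomp Require Import all_boot all_fingroup.

Set Implicit Arguments.
Unset Strict Implicit.
Unset Printing Implicit Defensive.

Record graph : Type := Graph {
  vertex :> finType;
  adj : rel vertex;
  adj_sym : symmetric adj;
  adj_irr : irreflexive adj }.

Definition deg (G : graph) (v : G) : nat := #|[set u | adj v u]|.

Definition maxdeg (G : graph) : nat := \max_(v : G) deg v.

Lemma deg_le (D : nat) (G : graph) (hG : maxdeg G <= D) (v : G) : deg v <= D.
Proof. exact: leq_trans (leq_bigmax v) hG. Qed.

(* Port numbers are counted from 0: [i : 'I_(deg v)] is port i+1 of [v]. *)
Definition port (G : graph) : finType := {v : G & 'I_(deg v)}.

Definition mkport (G : graph) (v : G) (i : 'I_(deg v)) : port G :=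
  Tagged (fun v : G => 'I_(deg v)) i.

(* [{perm port G}] is the type of bijections of the set of ports; a port
   numbering need not be an involution. *)
Definition port_numbering (G : graph) (p : {perm port G}) : Prop :=
  forall v u : G,
    (exists (i : 'I_(deg v)) (j : 'I_(deg u)), p (mkport i) = mkport j)
    <-> adj v u.

(* The sets of states and of messages may be infinite; only the set of stopping
   states is required to be finite. *)
Record machine (D : nat) (X : finType) : Type := Machine {
  stateT : Type;
  stopping : stateT -> Prop;
  stopping_finite : exists s : seq stateT, forall z, stopping z -> List.In z s;
  sigma0 : 'I_D.+1 -> X -> stateT;
  msgT : Type;
  eps : msgT;
  mu : stateT -> 'I_D -> msgT;
  mu_stop : forall z, stopping z -> forall i, mu z i = eps;
  sigma : stateT -> D.-tuple msgT -> stateT;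
  sigma_stop : forall z, stopping z -> forall m, sigma z m = z }.

Definition same_set (D : nat) (T : Type) (a b : D.-tuple T) : Prop :=
  forall m : T, (exists i, tnth a i = m) <-> (exists i, tnth b i = m).

Definition SV (D : nat) (X : finType) (A : machine D X) : Prop :=
  forall a b : D.-tuple (msgT A), same_set a b ->
  forall y : stateT A, sigma y a = sigma y b.

Section Execution.

Variables (D : nat) (X : finType) (A : machine D X).
Variables (G : graph) (hG : maxdeg G <= D) (f : G -> X) (p : {perm port G}).

Definition sent (x : G -> stateT A) (q : port G) : msgT A :=
  mu (x (tag q)) (widen_ord (deg_le hG (tag q)) (tagged q)).

(* The message arriving at input port [q] is the one sent from the output port
   [p^-1 q] connected to it. *)
Definition arriving (x : G -> stateT A) (q : port G) : msgT A :=
  sent x ((p^-1)%g q).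

(* [insub] turns [i < D] into a port of [v] when [i < deg v]; the remaining
   positions are padded with [eps]. *)
Definition inbox (x : G -> stateT A) (v : G) : D.-tuple (msgT A) :=
  [tuple oapp (fun k : 'I_(deg v) => arriving x (mkport k)) (eps A)
           (insub (val i)) | i < D].

Fixpoint state (r : nat) : G -> stateT A :=
  match r with
  | 0 => fun v =>
      sigma0 A (Ordinal (deg_le hG v : deg v < D.+1)) (f v)
  | r'.+1 => fun v => sigma (state r' v) (inbox (state r') v)
  end.

(* In round r >= 1, [v] receives the message [m] from its neighbour [u]; round r
   delivers messages computed from the states after r - 1 rounds. In a port
   numbering each neighbour [u] of [v] feeds exactly one input port of [v], so
   [m] is unique. *)
Definition receives_from (r : nat) (v u : G) (m : msgT A) : Prop :=
  exists (i : 'I_(deg v)) (j : 'I_(deg u)),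
    p (mkport j) = mkport i /\ arriving (state r.-1) (mkport i) = m.

End Execution.

(* Main.v *)
(* A machine in SV cannot count, so two nodes keep the same state as long as
   each label (output port number of the sender) that one of them hears from a
   neighbour is heard by the other from a neighbour that still looks the same;
   only the outgoing port numbers matter. With D = n + 1, we take a D-regular
   tree rooted at an edge {v, w}, whose nodes are alternately "right" (such as
   v) and "left" (such as w) and carry a level in 0..n, where:
   - a left node of level L hears each of the labels 0..n once, the label l
     from a right node of level min (L - 1) (n - l);
   - a right node of level k > 0 hears only the labels 0..n-1, the label a from
     a left node of level min k (n - a), and it hears one of these labels twice:
     from its parent and from a child;
   except that the parent may have a higher level than prescribed, which its
   child cannot notice in the rounds that matter.
   Left nodes of level at least L agree for 2L - 1 rounds, right nodes of level
   at least k for 2k rounds. The root v hears the label 0 both from w and from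
   one of its children, which have level n, hence agree for 2n - 1 = 2D - 3
   rounds. *)
Require Import Defs.
From mathcomp Require Import all_boot all_fingroup ssralg zmodp zify.

Set Implicit Arguments.
Unset Strict Implicit.
Unset Printing Implicit Defensive.

(** * Regular graphs and port numberings from rotation maps *)

Section RotationGraph.

Variables (D : nat) (V : finType) (rot : V * 'I_D -> V * 'I_D).

(** [rot (x, i) = (y, j)] says that port [i] of [x] and port [j] of [y] are the two ends of one
    edge. *)
Definition nbr (x : V) (i : 'I_D) : V := (rot (x, i)).1.
Definition back (x : V) (i : 'I_D) : 'I_D := (rot (x, i)).2.

Hypothesis rotK : involutive rot.
Hypothesis nbr_inj : forall x, injective (nbr x).
Hypothesis nbr_neq : forall x i, nbr x i != x.

Lemma rotE x i : rot (x, i) = (nbr x i, back x i).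
Proof. by rewrite /nbr /back; case: rot. Qed.

Lemma rot_back x i : rot (nbr x i, back x i) = (x, i).
Proof. by rewrite -rotE rotK. Qed.

Lemma nbr_back x i : nbr (nbr x i) (back x i) = x.
Proof. by rewrite {1}/nbr rot_back. Qed.

Lemma back_back x i : back (nbr x i) (back x i) = i.
Proof. by rewrite {1}/back rot_back. Qed.

Definition rot_adj : rel V := fun x y => [exists i, nbr x i == y].

Lemma rot_adj_sym : symmetric rot_adj.
Proof.
suff H x y : rot_adj x y -> rot_adj y x by move=> x y; apply/idP/idP; apply: H.
case/existsP=> i /eqP <-; apply/existsP; exists (back x i).
by rewrite nbr_back.
Qed.

Lemma rot_adj_irr : irreflexive rot_adj.
Proof. by move=> x; apply/existsP=> -[i]; apply/negP/nbr_neq. Qed.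

Definition rot_graph : graph := Graph rot_adj_sym rot_adj_irr.

Lemma deg_rot_graph (x : rot_graph) : deg x = D.
Proof.
rewrite -[RHS]card_ord -cardsT -(card_imset _ (@nbr_inj x)) /deg.
apply: eq_card => y; rewrite inE; apply/existsP/imsetP => [[i /eqP<-]|[i _ ->]].
  by exists i.
by exists i.
Qed.

Lemma maxdeg_rot_graph : V -> maxdeg rot_graph = D.
Proof.
move=> x0; apply/eqP; rewrite eqn_leq; apply/andP; split.
  by apply/bigmax_leqP => x _; rewrite deg_rot_graph.
by rewrite -{1}(deg_rot_graph x0) /maxdeg; apply: (leq_bigmax (F := @deg rot_graph)).
Qed.

Definition rport (x : rot_graph) (i : 'I_D) : port rot_graph :=
  mkport (cast_ord (esym (deg_rot_graph x)) i).

Lemma mkport_rport (x : rot_graph) (i : 'I_(deg x)) :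
  mkport i = rport x (cast_ord (deg_rot_graph x) i).
Proof. by rewrite /rport cast_ordK. Qed.

Definition rot_port (q : port rot_graph) : port rot_graph :=
  let r := rot (tag q, cast_ord (deg_rot_graph (tag q)) (tagged q)) in
  rport r.1 r.2.

Lemma rot_port_rport x i : rot_port (rport x i) = rport (nbr x i) (back x i).
Proof. by rewrite /rot_port /= cast_ordKV. Qed.

Lemma rot_portK : involutive rot_port.
Proof.
case=> x i; have -> : existT _ x i = rport x _ := mkport_rport i.
rewrite !rot_port_rport.
by rewrite nbr_back back_back -mkport_rport.
Qed.

Definition rot_perm : {perm port rot_graph} := perm (inv_inj rot_portK).

Lemma rot_permV : (rot_perm^-1)%g = rot_perm.
Proof.
apply/permP => q; apply: (@perm_inj _ rot_perm).
by rewrite permKV !permE rot_portK.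
Qed.

Lemma rot_perm_rport x i : rot_perm (rport x i) = rport (nbr x i) (back x i).
Proof. by rewrite permE rot_port_rport. Qed.

Lemma rot_port_numbering : port_numbering rot_perm.
Proof.
move=> x y; split=> [[i [j]]|/existsP[i /eqP xy]].
  rewrite mkport_rport rot_perm_rport => /(congr1 tag) /= xy.
  by apply/existsP; exists (cast_ord (deg_rot_graph x) i); rewrite xy.
subst y; exists (cast_ord (esym (deg_rot_graph x)) i).
exists (cast_ord (esym (deg_rot_graph (nbr x i))) (back x i)).
exact: rot_perm_rport.
Qed.

(* Stepwise indistinguishability: only the label [back x i] under which a
   neighbour sends to [x] is visible to [x], neither its input port nor its
   multiplicity. *)
Definition matched (R : V -> V -> Prop) (x y : V) : Prop :=
  forall i, exists2 j, back y j = back x i & R (nbr x i) (nbr y j).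

Fixpoint sim (r : nat) (x y : V) : Prop :=
  if r is r'.+1 then
    [/\ sim r' x y, matched (sim r') x y & matched (sim r') y x]
  else True.

Lemma sim_le r r' x y : r' <= r -> sim r x y -> sim r' x y.
Proof.
elim: r => [|r IHr]; first by rewrite leqn0 => /eqP->.
by rewrite leq_eqVlt ltnS => /predU1P[->//|/IHr H] [/H].
Qed.

Lemma sim_sym r x y : sim r x y -> sim r y x.
Proof. by elim: r => // r IHr [/IHr]; split. Qed.

(** * Executions on a rotation graph *)

Section Run.

Variables (X : finType) (f : rot_graph -> X) (A : machine D X).
Variable hG : maxdeg rot_graph <= D.
Hypothesis f_const : forall x y, f x = f y.
Hypothesis A_SV : SV A.

Lemma sent_rport s x i : sent hG s (rport x i) = mu (s x) i :> msgT A.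
Proof. by rewrite /sent /=; congr mu; apply: val_inj. Qed.

Lemma arriving_rport s x i :
  arriving hG rot_perm s (rport x i) = mu (s (nbr x i)) (back x i) :> msgT A.
Proof. by rewrite /arriving rot_permV rot_perm_rport sent_rport. Qed.

Lemma tnth_inbox s x i :
  tnth (inbox hG rot_perm s x) i = mu (s (nbr x i)) (back x i) :> msgT A.
Proof.
rewrite tnth_mktuple; case: insubP => [k _ ki|/negP[]]; last first.
  by rewrite (leq_trans (ltn_ord i)) // deg_rot_graph.
rewrite /= mkport_rport arriving_rport.
by have -> : cast_ord (deg_rot_graph x) k = i by apply: val_inj.
Qed.

Lemma sim_state r x y :
  sim r x y -> state A hG f rot_perm r x = state A hG f rot_perm r y.
Proof.
elim: r x y => [|r IHr] x y /=.
  move=> _; rewrite (f_const x y); congr sigma0.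
  by apply: val_inj; rewrite /= !deg_rot_graph.
have sub x' y' : matched (sim r) x' y' ->
    forall m, (exists i, tnth (inbox hG rot_perm (state A hG f rot_perm r) x') i = m) ->
    exists i, tnth (inbox hG rot_perm (state A hG f rot_perm r) y') i = m.
  move=> xy m [i <-]; have [j bij /IHr Eij] := xy i.
  by exists j; rewrite !tnth_inbox bij Eij.
case=> /IHr -> xy yx; apply: A_SV => m.
by split; apply: sub.
Qed.

Lemma receives_nbr r x i :
  receives_from hG f rot_perm r (nbr x i) x
    (mu (state A hG f rot_perm r.-1 x) i).
Proof.
exists (cast_ord (esym (deg_rot_graph (nbr x i))) (back x i)).
exists (cast_ord (esym (deg_rot_graph x)) i); split; first exact: rot_perm_rport.
by rewrite -/(rport _ _) arriving_rport nbr_back back_back.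
Qed.

End Run.

End RotationGraph.

(** * The labelled tree and its rotation map *)

Section Tree.

Variable m : nat.
Local Notation n := m.+1.
Local Notation D := n.+1.

(* [up] is the output port towards the parent, and [dn] the output port of the
   parent towards the node, i.e. the label heard from the parent. *)
Record label : Type := Label {
  right : bool;
  lev : nat;
  up : 'I_D;
  dn : 'I_D }.

(* A right node hears the label [a] from its child [a]. A left node hears from
   behind its output port [q] the label [tperm dn up q]: this sends [up] to
   [dn], as it must, and every other port, with at most one exception, to itself. *)
Definition child_label (t : label) (a : 'I_n) : label :=
  let q := lift (up t) a in
  if right t then Label false (minn (lev t) (n - a)) (widen_ord (leqnSn n) a) q
  else let i := tperm (dn t) (up t) q in
       Label true (minn (lev t).-1 (n - i)) i q.

Definition root_label (b : bool) : label := Label b n ord0 ord0.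

(* A side of the root edge, the child indices leading to the node (the last one
   first), and a copy number, which serves only to make the graph regular: see
   [bridge]. *)
Definition address : finType := (bool * n.*2.-bseq 'I_n * 'I_n)%type.

Implicit Types x y : address.

Definition depth x : nat := size x.1.2.

Definition label_of (b : bool) (s : seq 'I_n) : label :=
  foldr (fun a t => child_label t a) (root_label b) s.

Definition lab x : label := label_of x.1.1 x.1.2.

Definition parent x : address :=
  let: (b, s, c) := x in
  if nilp s then (~~ b, s, c)
  else (b, insub_bseq n.*2 (behead s), c).

Definition child x (a : 'I_n) : address :=
  let: (b, s, c) := x in (b, insub_bseq n.*2 (a :: s), c).

(* The neighbours, other than the parent, of a node of maximal depth: joining the
   copies of the tree there avoids nodes of small degree. *)
Definition bridge x (a : 'I_n) : address :=
  let: (b, s, c) := x in (~~ b, s, (a - c)%R).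

Definition tree_rot (xi : address * 'I_D) : address * 'I_D :=
  let: (x, i) := xi in
  if unlift (up (lab x)) i is Some a then
    if depth x < n.*2 then (child x a, up (lab (child x a)))
    else (bridge x a, lift (up (lab (bridge x a))) a)
  else (parent x, dn (lab x)).

Lemma insub_bseqK (k : nat) (s : seq 'I_n) : size s <= k -> insub_bseq k s = s :> seq _.
Proof. by move=> sk; rewrite /insub_bseq insubdK. Qed.

Lemma lab_child x a : depth x < n.*2 -> lab (child x a) = child_label (lab x) a.
Proof. by case: x => [[b s] c] sN; rewrite /lab /= insub_bseqK. Qed.

Lemma depth_child x a : depth x < n.*2 -> depth (child x a) = (depth x).+1.
Proof. by case: x => [[b s] c] sN; rewrite /depth /= insub_bseqK. Qed.

Lemma parent_child x a : depth x < n.*2 -> parent (child x a) = x.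
Proof.
case: x => [[b s] c] sN; rewrite /parent /= insub_bseqK //=.
by congr (_, _, _); apply: val_inj; rewrite /= insub_bseqK // ltnW.
Qed.

Lemma dn_child_label t a : dn (child_label t a) = lift (up t) a.
Proof. by rewrite /child_label; case: ifP. Qed.

Variant parent_spec x : address -> Type :=
  | RootParent of x.1.2 = [bseq] :
      parent_spec x (~~ x.1.1, x.1.2, x.2)
  | ChildParent y a of depth y < n.*2 & x = child y a : parent_spec x y.

Lemma parentP x : parent_spec x (parent x).
Proof.
case: x => [[b [[|a s] sN]] c]; rewrite /parent.
  by apply: RootParent; apply: val_inj.
have sN' : size s <= n.*2 by exact: ltnW.
apply: (@ChildParent _ _ a); first by rewrite /depth /= insub_bseqK.
by congr (_, _, _); apply: val_inj; rewrite /= !insub_bseqK //= insub_bseqK.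
Qed.

Lemma tree_rotK : involutive tree_rot.
Proof.
case=> x i; rewrite /tree_rot; case: unliftP => [a -> {i}|-> {i}].
  case: ifP => [xN|xN].
    by rewrite unlift_none parent_child // lab_child // dn_child_label.
  rewrite liftK; have -> : depth (bridge x a) = depth x by case: x xN => [[]].
  rewrite xN; have -> : bridge (bridge x a) a = x.
    by case: x xN => [[b s] c] _; rewrite /bridge negbK GRing.subKr.
  by [].
case: (parentP x) => [x0|y a yN ->].
  case: x x0 => [[b s] c] /= ->; rewrite /lab /= unlift_none /= negbK.
  by [].
by rewrite lab_child // dn_child_label liftK yN lab_child.
Qed.

Local Notation tnbr := (nbr tree_rot).
Local Notation tback := (back tree_rot).

Lemma nbr_up x : tnbr x (up (lab x)) = parent x.
Proof. by rewrite /nbr /= unlift_none. Qed.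

Lemma back_up x : tback x (up (lab x)) = dn (lab x).
Proof. by rewrite /back /= unlift_none. Qed.

Lemma nbr_lift x a : depth x < n.*2 -> tnbr x (lift (up (lab x)) a) = child x a.
Proof. by move=> xN; rewrite /nbr /= liftK xN. Qed.

Lemma back_lift x a : depth x < n.*2 ->
  tback x (lift (up (lab x)) a) = up (child_label (lab x) a).
Proof. by move=> xN; rewrite /back /= liftK xN -lab_child. Qed.

Lemma depth_parent x : depth (parent x) = (depth x).-1.
Proof.
case: (parentP x) => [|y a yN ->]; last by rewrite depth_child.
by rewrite /depth => /= ->.
Qed.

Lemma child_inj x : depth x < n.*2 -> injective (child x).
Proof.
case: x => [[b s] c] sN a a' /(congr1 (fun x => (val x.1.2))) /=.
by rewrite !insub_bseqK // => -[].
Qed.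

Lemma bridge_inj x : injective (bridge x).
Proof. by case: x => [[b s] c] a a' /(congr1 snd) /GRing.addIr. Qed.

Lemma parent_neq_child x a : depth x < n.*2 -> parent x != child x a.
Proof.
move=> xN; apply/eqP => /(congr1 depth); rewrite depth_parent depth_child //.
by move/eqP; rewrite ltn_eqF // (leq_ltn_trans (leq_pred _)).
Qed.

(** A node of maximal depth is not a root, as [n.*2 > 0], so its parent has smaller depth, whereas a
    bridge keeps the depth. *)
Lemma parent_neq_bridge x a : ~~ (depth x < n.*2) -> parent x != bridge x a.
Proof.
move=> xN; apply/eqP => /(congr1 depth); rewrite depth_parent.
have -> : depth (bridge x a) = depth x by case: x xN => [[]].
by case: (depth x) xN => // k _ /eqP; rewrite ltn_eqF.
Qed.

Lemma nbr_lift_leaf x a :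
  ~~ (depth x < n.*2) -> tnbr x (lift (up (lab x)) a) = bridge x a.
Proof. by move=> xN; rewrite /nbr /= liftK (negPf xN). Qed.

Lemma tree_nbr_inj x : injective (tnbr x).
Proof.
suff [g [g_inj gN gE]] : exists g : 'I_n -> address,
    [/\ injective g, forall a, parent x != g a
      & forall a, tnbr x (lift (up (lab x)) a) = g a].
  move=> i j; case: (unliftP (up (lab x)) i) => [a ->|->];
    case: (unliftP (up (lab x)) j) => [a' ->|->] //; rewrite ?nbr_up ?gE.
  - by move/g_inj ->.
  - by move/esym/eqP; rewrite (negPf (gN _)).
  - by move/eqP; rewrite (negPf (gN _)).
have [xN|xN] := boolP (depth x < n.*2).
  exists (child x); split=> [|a|a]; first exact: child_inj.
    exact: parent_neq_child.
  exact: nbr_lift.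
exists (bridge x); split=> [|a|a]; first exact: bridge_inj.
  exact: parent_neq_bridge.
exact: nbr_lift_leaf.
Qed.

Lemma tree_nbr_neq x i : tnbr x i != x.
Proof.
have b_neq b : (~~ b == b) = false by case: b.
case: (unliftP (up (lab x)) i) => [a ->|->]; last first.
  rewrite nbr_up; case: (parentP x) => [_|y a yN ->].
    by case: x => [[b s] c]; rewrite !xpair_eqE b_neq.
  by apply/eqP => /(congr1 depth) /eqP; rewrite depth_child // ltn_eqF.
have [xN|xN] := boolP (depth x < n.*2).
  rewrite nbr_lift //; apply/eqP => /(congr1 depth) /eqP.
  by rewrite depth_child // gtn_eqF.
by rewrite nbr_lift_leaf //; case: x xN => [[b s] c] _; rewrite !xpair_eqE b_neq.
Qed.

(** The bounds put [up t] and [dn t] below the labels [l] with [n - l] small against the level, so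
    that the exceptional ports do not affect the subtrees behind those labels. *)
Definition label_ok (t : label) : Prop :=
  up t + lev t <= n /\ dn t + lev t <= n + ~~ right t.

Lemma child_label_ok t a : label_ok t -> label_ok (child_label t a).
Proof.
case: t => [[] k j e]; rewrite /label_ok /child_label /=; case=> jk ek.
  have := ltn_ord a; rewrite /bump; case: (j <= a) => /=; lia.
have /eqP jq : j != lift j a by rewrite neq_lift.
have := ltn_ord (lift j a); have := ltn_ord j.
case: tpermP => [/(congr1 val)|/esym//|_ _] /=; lia.
Qed.

Lemma lab_ok x : label_ok (lab x).
Proof.
case: x => [[b s] c]; rewrite /lab /=; elim: {s}(val s) => [|a s IHs] /=.
  by rewrite /label_ok /= !add0n leq_addr.
exact: child_label_ok.
Qed.

Lemma right_parent x : right (lab (parent x)) = ~~ right (lab x).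
Proof.
case: (parentP x) => [|y a yN ->]; first by rewrite /lab /= => ->.
by rewrite lab_child // /child_label; case: (right (lab y)).
Qed.

Lemma lev_parent x : lev (lab x) <= lev (lab (parent x)).
Proof.
case: (parentP x) => [|y a yN ->]; first by rewrite /lab /= => ->.
rewrite lab_child // /child_label; case: ifP => /= _; first exact: geq_minl.
by rewrite geq_min leq_pred.
Qed.

(** * Indistinguishability of nodes *)

Local Notation tsim := (sim tree_rot).

(* The second alternative covers the nodes of low level: equal labels determine
   equal subtrees, so only the parents have to be compared. *)
Definition alike (r : nat) x y : Prop :=
  [/\ right (lab x) = right (lab y), depth x + r <= n.*2, depth y + r <= n.*2
    & r < (minn (lev (lab x)) (lev (lab y))).*2 + right (lab x) \/
      lab x = lab y /\ tsim r.-1 (parent x) (parent y)].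


Lemma alike_near r x y :
  right (lab x) = right (lab y) -> depth x + r <= n.*2 -> depth y + r <= n.*2 ->
  r < (minn (lev (lab x)) (lev (lab y))).*2 + right (lab x) -> alike r x y.
Proof. by move=> xy xr yr H; split=> //; left. Qed.

Lemma alike_child r x y a b :
  depth x + r < n.*2 -> depth y + r < n.*2 ->
  child_label (lab x) a = child_label (lab y) b -> tsim r.-1 x y ->
  alike r (child x a) (child y b).
Proof.
move=> xr yr ab xy.
have [xN yN] : depth x < n.*2 /\ depth y < n.*2 by split; lia.
by split; rewrite ?lab_child ?depth_child ?parent_child // ?ab //; right.
Qed.

Lemma alike_sym r x y : alike r x y -> alike r y x.
Proof.
case=> xy xr yr H; split=> //; rewrite minnC -xy.
by case: H => [|[-> /sim_sym]]; [left | right].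
Qed.

Lemma alike_pred r x y : alike r.+1 x y -> alike r x y.
Proof.
case=> xy xr yr H; split=> //; [lia | lia |].
case: H => [H|[-> H]]; [left; lia | right; split=> //].
exact: sim_le (leq_pred _) H.
Qed.

Lemma portP (j i : 'I_D) : i = j \/ exists a : 'I_n, i = lift j a.
Proof. by case: (unliftP j i) => [a|]; [right; exists a | left]. Qed.

(** The transposition is its own inverse, so [q] is the port behind which [x] hears [l]. *)
Lemma left_nbr x l (q := tperm (dn (lab x)) (up (lab x)) l) :
  right (lab x) = false -> depth x < n.*2 ->
  tback x q = l /\
  (l = dn (lab x) /\ tnbr x q = parent x \/
   exists a, [/\ l <> dn (lab x), tnbr x q = child x a
     & child_label (lab x) a = Label true (minn (lev (lab x)).-1 (n - l)) l q]).
Proof.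
move=> xl xN; have [le|/eqP le] := eqVneq l (dn (lab x)).
  by rewrite /q le tpermL nbr_up back_up; split=> //; left.
have ql : l = tperm (dn (lab x)) (up (lab x)) q by rewrite tpermK.
have [qu|[a qa]] := portP (up (lab x)) q; first by case: le; rewrite ql qu tpermR.
have la : child_label (lab x) a = Label true (minn (lev (lab x)).-1 (n - l)) l q.
  by rewrite /child_label xl -qa -ql.
rewrite qa back_lift // nbr_lift // la; split=> //.
by right; exists a; rewrite la qa.
Qed.

Lemma alike_sim r x y : alike r x y -> tsim r x y.
Proof.
elim: r x y => // r IHr.
suff step x y : alike r.+1 x y -> matched tree_rot (tsim r) x y.
  move=> x y xy; split; first by apply/IHr/alike_pred.
    exact: step.
  exact/step/alike_sym.
move=> xy; have Sxy : tsim r.-1 x y.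
  by apply: sim_le (leq_pred _) _; apply/IHr/alike_pred.
case: xy => xy xr yr H i.
have [xN yN] : depth x < n.*2 /\ depth y < n.*2 by split; lia.
have [okx oky] := (lab_ok x, lab_ok y).
have [px py] := (right_parent x, right_parent y).
have [lx ly] := (lev_parent x, lev_parent y).
have [dx dy] := (depth_parent x, depth_parent y).
have {xy} ry := esym xy; rewrite ry in py; rewrite /label_ok ry in okx oky.
case rx: (right (lab x)) in ry px py H okx oky *; rewrite /= in px py H okx oky.
  case: (portP (up (lab x)) i) => [->|[a ->]]; last first.
    exists (lift (up (lab y)) a).
      by rewrite !back_lift // /child_label rx ry.
    rewrite !nbr_lift //; apply: IHr; case: H => [H|[E _]]; last first.
      by apply: alike_child; rewrite ?E //; lia.
    (* If [n - a] is below both levels, the two children have equal labels, and only their parents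
       [x] and [y] remain to be compared. *)
    have [le|gt] := leqP (minn (lev (lab x)) (lev (lab y))) (n - a).
      apply: alike_near;
        rewrite ?lab_child ?depth_child // /child_label ?rx ?ry //=; lia.
    apply: alike_child => //; try lia; rewrite /child_label rx ry.
    congr Label; first lia.
    apply: val_inj; rewrite /= /bump.
    have -> : up (lab x) <= a by lia.
    by have -> : up (lab y) <= a by lia.
  case: H => [H|[E S]]; last first.
    exists (up (lab y)); first by rewrite !back_up E.
    by rewrite !nbr_up.
  (* The level of [x] is positive, so the label that [x] hears from its parent is one that [y] hears
     from a child. *)
  have en : dn (lab x) < n by lia.
  exists (lift (up (lab y)) (Ordinal en)).
    rewrite back_up back_lift // /child_label ry; exact: val_inj.
  rewrite nbr_up nbr_lift //; apply: IHr; apply: alike_near;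
    rewrite ?lab_child ?depth_child // ?px /child_label ?ry //=; lia.
pose l := tperm (dn (lab x)) (up (lab x)) i.
have -> : i = tperm (dn (lab x)) (up (lab x)) l by rewrite tpermK.
have [bx nx] := left_nbr l rx xN; have [by_ ny] := left_nbr l ry yN.
exists (tperm (dn (lab y)) (up (lab y)) l); first by rewrite bx by_.
case: H => [H|[E S]]; last first.
  case: nx ny => [[lx0 ->]|[a [lx0 -> cx]]] [[ly0 ->]|[b [ly0 -> cy]]] //.
  - by rewrite -E in ly0.
  - by rewrite -E in ly0.
  by apply/IHr/alike_child; rewrite ?cx ?cy ?E //; lia.
(* Passing from left to right may cost one level, but only one round: 2(L - 1) + 1 = 2L - 1. *)
have [le|gt] := leqP (minn (lev (lab x)) (lev (lab y))).-1 (n - l).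
  apply/IHr/alike_near.
  - by case: nx ny => [[_ ->]|[a [_ -> cx]]] [[_ ->]|[b [_ -> cy]]];
      rewrite ?lab_child ?px ?py ?cx ?cy.
  - by case: nx => [[_ ->]|[a [_ -> cx]]]; rewrite ?depth_child //; lia.
  - by case: ny => [[_ ->]|[a [_ -> cx]]]; rewrite ?depth_child //; lia.
  case: nx ny => [[_ ->]|[a [_ -> cx]]] [[_ ->]|[b [_ -> cy]]];
    rewrite ?lab_child ?px ?py ?cx ?cy //=; lia.
(* So large a label exceeds [dn] on both sides, hence comes from children. *)
case: nx => [[lx0 _]|[a [lx0 -> cx]]]; first by rewrite lx0 in gt; lia.
case: ny => [[ly0 _]|[b [ly0 -> cy]]]; first by rewrite ly0 in gt; lia.
apply/IHr/alike_child => //; try lia; rewrite cx cy.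
(* It exceeds [up] too, so both transpositions fix it and the children have equal labels. *)
have tl (t : label) : l <> dn t -> up t + lev t <= n -> n - l < (lev t).-1 ->
    tperm (dn t) (up t) l = l.
  move=> lt ut nt; rewrite tpermD //; apply/eqP => ll; first exact: lt.
  by move: nt; rewrite -ll; lia.
rewrite !tl //; try lia.
by congr Label; lia.
Qed.

Definition root (b : bool) : address := (b, [bseq], ord0).

(** Both are left nodes of level n, and 2n - 1 rounds from depth at most 1 fit exactly into the
    depth bound [n.*2]. *)
Lemma sim_root_child :
  tsim n.*2.-1 (child (root true) ord0) (root false).
Proof.
have d0 b : depth (root b) = 0 by [].
apply: alike_sim; apply: alike_near;
  by rewrite ?depth_child ?lab_child ?d0 //= /child_label /= ?minnn ?subn0; lia.
Qed.

End Tree.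

Theorem theorem1 (D : nat) (hD : 2 <= D) :
  exists (G : graph) (hG : maxdeg G = D) (p : {perm port G}) (v u w : G),
    port_numbering p /\
    adj v u /\ adj v w /\ u <> w /\
    forall (X : finType) (no_input : X) (A : machine D X), SV A ->
    forall r : nat, 1 <= r <= 2 * D - 2 ->
    exists m : msgT A,
      receives_from (eq_leq hG) (fun _ : G => no_input) p r v u m /\
      receives_from (eq_leq hG) (fun _ : G => no_input) p r v w m.
Proof.
case: D hD => [|[|m]] // _.
pose K := @tree_rotK m; pose I := @tree_nbr_inj m; pose N := @tree_nbr_neq m.
pose v := root m true; pose u := child v ord0; pose w := root m false.
have uv : nbr (@tree_rot m) u ord0 = v.
  have <- : up (lab u) = ord0 by rewrite lab_child //; apply: val_inj.
  by rewrite nbr_up parent_child.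
have wv : nbr (@tree_rot m) w ord0 = v by rewrite (nbr_up w).
have adj_v x : nbr (@tree_rot m) x ord0 = v -> rot_adj (@tree_rot m) v x.
  by move=> xv; rewrite rot_adj_sym //; apply/existsP; exists ord0; rewrite xv.
exists (rot_graph K N), (maxdeg_rot_graph K I N v), (rot_perm K I N), v, u, w.
split; first exact: rot_port_numbering.
split; first exact: adj_v.
split; first exact: adj_v.
split; first by move/(congr1 (fun x : address m => x.1.1)).
move=> X no_input A A_SV r /andP[r_gt0 r_le].
have recv x := @receives_nbr _ _ _ K I N X (fun=> no_input) A
  (eq_leq (maxdeg_rot_graph K I N v)) r x ord0.
have := recv w; have := recv u; rewrite uv wv => recv_u recv_w.
eexists; split; first exact: recv_u.
(* Both send to [v] through port 0, from states after r - 1 <= 2D - 3 = 2n - 1 rounds, where n = D -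
   1. *)
rewrite (@sim_state _ _ _ K I N _ _ _ _ _ _ r.-1 u w) //.
by apply: sim_le (sim_root_child m); lia.
Qed.
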